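(* The chain polynomial of any paving lattice $L$ is real-rooted and all of its zeros lie in the interval $[-1,0]$. Moreover, if $S$ is a set of nonnegative integers, then the chain polynomial of the rank selected subposet $L_S$ is real-rooted with all zeros in $[-1,0]$.
   Context: The chain polynomial of a finite poset $P$ is $c_P=\sum_{k\ge 0}c_k(P)t^k$, where $c_k(P)$ is the number of $k$-element chains of $P$. A geometric lattice is a semimodular lattice (graded, with rank function $\rho$ satisfying $\rho(x)+\rho(y)\ge\rho(x\wedge y)+\rho(x\vee y)$) that is atomistic (each element other than $\hat 0$ is a join of atoms). A family $\mathcal{H}$ of two or more sets is a $d$-partition of $\bigcup\mathcal{H}$ if every set in $\mathcal{H}$ has at least $d$ elements and every $d$-element subset of $\bigcup\mathcal{H}$ is a subset of exactly one set in $\mathcal{H}$. For a $d$-partition $\mathcal{H}$ of $[n]=\{1,\dots,n\}$, let $\mathbb{B}_n(\mathcal{H},[n],d)$ be the poset, ordered by inclusion, consisting of all subsets of $[n]$ with at most $d-1$ elements, all members of $\mathcal{H}$ (which are its elements of rank $d$), and $[n]$ (its only element of rank $d+1$). A finite geometric lattice $L$ of rank $d+1$ is a paving lattice if $d\in\{0,1\}$, or if $d\ge 2$ and $L$ is isomorphic to $\mathbb{B}_n(\mathcal{H},[n],d)$ for some $n$ and some $d$-partition $\mathcal{H}$ of $[n]$. (These are the lattices of flats of paving matroids.) For a graded poset $L$ with rank function $\rho$ and a set $S$ of nonnegative integers, $L_S=\{x\in L:\rho(x)\in S\}$ with the induced order. *)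

(* Defs.v *)
From HB Require Import structures.
From mathcomp Require Import classical_sets reals.
From mathcomp Require Import complex.
From mathcomp Require Import all_boot all_order all_algebra.
Set Implicit Arguments.
Unset Strict Implicit.
Unset Printing Implicit Defensive.
Import Order.TTheory GRing.Theory Num.Theory.
Local Open Scope order_scope.

(* Orders {set T} by inclusion. *)
Import Order.DefaultSetSubsetOrder.

Definition is_chain {disp : Order.disp_t} {P : finPOrderType disp}
    (A : {set P}) : bool :=
  [forall x in A, forall y in A, x >=< y].

Definition chain_count {disp : Order.disp_t} (P : finPOrderType disp)
    (k : nat) : nat :=
  #|[set A : {set P} | is_chain A & #|A| == k]|.

(* A chain of P has at most #|P| elements, so no coefficient is cut off. *)
Definition chain_poly (R : realType) {disp : Order.disp_t}
    (P : finPOrderType disp) : {poly R} :=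
  (\poly_(k < #|P|.+1) (chain_count P k)%:R)%R.

Definition real_rooted (R : realType) (p : {poly R}) : Prop :=
  forall z : R[i],
    root (map_poly (real_complex R) p) z -> exists x : R, z = real_complex R x.

Definition zeros_in_N1_0 (R : realType) (p : {poly R}) : Prop :=
  forall x : R, root p x -> (-1 <= x <= 0)%R.

Definition covers {disp : Order.disp_t} {P : finPOrderType disp}
    (x y : P) : bool :=
  (x < y) && ~~ [exists z : P, x < z < y].

Definition is_rank_function {disp : Order.disp_t} {L : finTBLatticeType disp}
    (rho : L -> nat) : Prop :=
  rho \bot = 0%N /\ forall x y : L, covers x y -> rho y = (rho x).+1.

Definition semimodular {disp : Order.disp_t} {L : finTBLatticeType disp}
    (rho : L -> nat) : Prop :=
  forall x y : L, (rho (x `&` y) + rho (x `|` y) <= rho x + rho y)%N.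

Definition atomistic {disp : Order.disp_t} (L : finTBLatticeType disp) : Prop :=
  forall x : L, x != \bot ->
    exists A : {set L},
      (forall a : L, a \in A -> covers \bot a) /\ x = \join_(a in A) a.

(* The rank function of a graded poset with \bot is unique; it is kept as an
   argument so that ranks can be referred to. *)
Definition geometric_lattice {disp : Order.disp_t} {L : finTBLatticeType disp}
    (rho : L -> nat) : Prop :=
  [/\ is_rank_function rho, semimodular rho & atomistic L].

Definition d_partition {T : finType} (d : nat) (H : {set {set T}}) : Prop :=
  [/\ (2 <= #|H|)%N,
      forall A : {set T}, A \in H -> (d <= #|A|)%N
    & forall D : {set T}, D \subset cover H -> #|D| = d ->
        exists! A : {set T}, (A \in H) && (D \subset A)].

Definition paving_mem (n : nat) (H : {set {set 'I_n}}) (d : nat) :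
    pred {set 'I_n} :=
  fun A => [|| (#|A| <= d.-1)%N, A \in H | A == [set: 'I_n]].

Definition paving_poset (n : nat) (H : {set {set 'I_n}}) (d : nat) : Type :=
  {A : {set 'I_n} | paving_mem H d A}.

Section PavingPoset.
Variables (n : nat) (H : {set {set 'I_n}}) (d : nat).
HB.instance Definition _ := SubType.copy (paving_poset H d)
  {A : {set 'I_n} | paving_mem H d A}.
HB.instance Definition _ := Finite.copy (paving_poset H d)
  {A : {set 'I_n} | paving_mem H d A}.
HB.instance Definition _ :=
  [SubChoice_isSubPOrder of paving_poset H d by <: with Order.SetSubsetOrder.subset_display].
End PavingPoset.

Definition order_isomorphic {disp disp' : Order.disp_t}
    (P : porderType disp) (Q : porderType disp') : Prop :=
  exists2 f : P -> Q, bijective f & {mono f : x y / x <= y}.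

Definition paving_lattice {disp : Order.disp_t} {L : finTBLatticeType disp}
    (rho : L -> nat) : Prop :=
  geometric_lattice rho /\
  exists d : nat, rho \top = d.+1 /\
    (d = 0%N \/ d = 1%N \/
     (2 <= d)%N /\
     exists (n : nat) (H : {set {set 'I_n}}),
       [/\ d_partition d H, cover H = [set: 'I_n]
         & order_isomorphic L (paving_poset H d)]).

Definition rank_selected {disp : Order.disp_t} {L : finPOrderType disp}
    (rho : L -> nat) (S : set nat) : Type :=
  {x : L | rho x \in S}.

Section RankSelected.
Variables (disp : Order.disp_t) (L : finPOrderType disp).
Variables (rho : L -> nat) (S : set nat).
HB.instance Definition _ := SubType.copy (rank_selected rho S)
  {x : L | rho x \in S}.
HB.instance Definition _ := Finite.copy (rank_selected rho S)
  {x : L | rho x \in S}.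
HB.instance Definition _ :=
  [SubChoice_isSubPOrder of rank_selected rho S by <: with disp].
End RankSelected.

(* Main.v *)
From HB Require Import structures.
Require Import Defs.
From mathcomp Require Import classical_sets reals.
From mathcomp Require Import all_boot all_order all_algebra.
From mathcomp Require Import complex.
From mathcomp Require Import ring zify.
Set Implicit Arguments.
Unset Strict Implicit.
Unset Printing Implicit Defensive.
Import Order.TTheory GRing.Theory Num.Theory.
Import Order.DefaultSetSubsetOrder.
Local Open Scope ring_scope.

(** Let S be the set of selected ranks.  In a paving lattice of rank d + 1 the
elements of rank below d are the small subsets of [n], those of rank d are the
blocks A of the d-partition, and below a block A lie the small subsets of A.
Cutting chains at their top element, the chain polynomial is therefore, up to
a factor 1 + t for the maximum of the lattice,
   p_n + t * sum_A p_{#|A|}                (if d is in S; otherwise p_n),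
where p_m is the chain polynomial of the subsets of an m-element set whose
size is in S and smaller than d ([paving_chain_gf]).

All zeros are in [-1, 0] if no complex z outside [-1, 0] is a zero, so z is
fixed and everything is evaluated at z.  Put x = z / (1 + z), which is not
a nonpositive real; hence the cone spanned by 1 and x is pointed.  Say that
f precedes g if f^* g is in this cone.  As z runs over the upper half plane
this encodes interlacing of polynomials, but it is a condition at one point
that is stable under nonnegative combinations in both arguments.

The numbers p_m are nonnegative combinations, with binomial weights
C(m - i - 1, d - 1 - i), of numbers b_0, ..., b_(d-1) that do not depend on m
([refined], [boolean_cp]).  The b_i satisfy the recursion of the Eulerian
polynomials refined by the last letter of a permutation, and this recursion
preserves the property that b_l precedes b_i whenever i <= l
([refined_precedes]).  As the cone is pointed, positive combinations of the
b_i do not vanish; this settles p_n.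

For p_n + z q with q = sum_A p_{#|A|}, write it as (1 + z)(p_n + x (q - p_n)).
The ratio of the weight of b_i in q to its weight in p_n is nondecreasing in i
([bin_ratio]).  The same monotonicity at i = -1 shows that the ratio is at least
sum_A C(#|A|, d) / C(n, d), which is at least 1 because every d-subset of [n]
lies in some block.  So q - p_n has nonnegative weights, of nondecreasing ratio
to those of p_n; hence q - p_n precedes p_n ([precedes_rising]), and pointedness
of the cone again excludes p_n + x (q - p_n) = 0 ([paving_neq0]).

In rank 1 or 2 the elements other than the minimum and the maximum form an
antichain, and the chain polynomial is a product of factors 1 + k t. *)

(** * Refined chain polynomials of truncated Boolean lattices *)

Section Refined.
Variables (K : comNzRingType) (s : pred nat) (t : K).

(** At t = x (1 + t), [refined J i] is (1 + t) ^ e times the sum, over the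
permutations of {0, ..., J} with last letter i and all descent positions in s,
of x to the number of descents; e is the number of elements of s in
{1, ..., J}.  An element 0 of s contributes a factor 1 + t. *)
Fixpoint refined (J i : nat) : K :=
  if J is J'.+1 then
    \sum_(0 <= l < i) refined J' l
      + (s J)%:R * t * \sum_(0 <= l < J) refined J' l
  else 1 + (s 0)%:R * t.

(** The chain polynomial of the subsets of an m-element set that have size in s
and at most J, when J < m; see [chain_gf_boolean].  In terms of permutations of
m letters without descents after position J, the binomial coefficient
counts the choices of the set of the first J + 1 letters, given that the last
of them has relative value i. *)
Definition boolean_cp (J m : nat) : K :=
  \sum_(0 <= i < J.+1) 'C(m - i.+1, J - i)%:R * refined J i.

Lemma bin_hockey_stick (m i k : nat) : (i + k < m)%N ->
  (\sum_(i <= l < (i + k).+1) 'C(m - l.+1, (i + k) - l) = 'C(m - i, k))%N.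
Proof.
elim: k i => [|k IH] i im.
  by rewrite addn0 big_nat1 subnn !bin0.
rewrite big_ltn ?ltnS ?leq_addr // addKn -addSnnS IH; last by lia.
have -> : (m - i = (m - i.+1).+1)%N by lia.
by rewrite binS.
Qed.

Lemma boolean_cp0 m : boolean_cp 0 m = 1 + (s 0)%:R * t.
Proof. by rewrite /boolean_cp big_nat1 bin0 mul1r. Qed.

Lemma boolean_cp_diag J : boolean_cp J J.+1 = \sum_(0 <= l < J.+1) refined J l.
Proof. by apply: eq_big_nat => i /andP[_ iJ]; rewrite subSS binn mul1r. Qed.

(** Besides the chains that avoid size J + 1 there are, if J + 1 is in s, those
whose top element is one of the C(m, J + 1) sets of that size. *)
Lemma boolean_cpS J m : (J.+1 < m)%N ->
  boolean_cp J.+1 m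
    = boolean_cp J m + (s J.+1)%:R * t * 'C(m, J.+1)%:R * boolean_cp J J.+1.
Proof.
move=> Jm; rewrite boolean_cp_diag {1}/boolean_cp /=.
set w := (s J.+1)%:R * t * _.
under eq_bigr do rewrite mulrDr.
rewrite big_split /= -mulr_suml; congr (_ + _).
- under eq_big_nat => i /andP[_ iJ] do
    rewrite (big_nat_widen _ _ J.+1) //= mulr_sumr.
  rewrite (exchange_big_dep_nat xpredT) //=.
  apply: eq_big_nat => l /andP[_ lJ].
  rewrite -mulr_suml -natr_sum; congr (_%:R * _).
  have := @bin_hockey_stick m l.+1 (J - l); rewrite addSn subnKC // => <- //.
  rewrite [RHS](big_nat_widenl _ 0) //.
- rewrite -natr_sum; have := @bin_hockey_stick m 0 J.+1; rewrite add0n subn0 => -> //.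
  by rewrite /w; ring.
Qed.

End Refined.

Lemma refined_morph (K K' : comNzRingType) (f : {rmorphism K -> K'}) s t J i :
  f (refined s t J i) = refined s (f t) J i.
Proof.
elim: J i => [|J IH] i /=; first by rewrite rmorphD rmorph1 rmorphM rmorph_nat.
rewrite rmorphD !rmorphM rmorph_nat !rmorph_sum /=.
by congr (_ + _ * _); apply: eq_bigr => l _; apply: IH.
Qed.

Lemma boolean_cp_morph (K K' : comNzRingType) (f : {rmorphism K -> K'})
    s t J m :
  f (boolean_cp s t J m) = boolean_cp s (f t) J m.
Proof.
rewrite rmorph_sum; apply: eq_bigr => i _.
by rewrite rmorphM rmorph_nat refined_morph.
Qed.

(** * Interlacing at a point *)

Section Cone.
Variables (C : numClosedFieldType) (x : C).

Definition cone (u : C) : Prop :=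
  exists a b, [/\ 0 <= a, 0 <= b & u = a + b * x].

Lemma coneD u v : cone u -> cone v -> cone (u + v).
Proof.
move=> [a [b [a0 b0 ->]]] [c [e [c0 e0 ->]]].
by exists (a + c), (b + e); split; rewrite ?addr_ge0 //; ring.
Qed.

Lemma coneM k u : 0 <= k -> cone u -> cone (k * u).
Proof.
move=> k0 [a [b [a0 b0 ->]]].
by exists (k * a), (k * b); split; rewrite ?mulr_ge0 //; ring.
Qed.

Lemma cone_ge0 k : 0 <= k -> cone k.
Proof. by move=> k0; exists k, 0; rewrite mul0r addr0. Qed.

Lemma cone0 : cone 0. Proof. exact: cone_ge0. Qed.

Lemma coneX k : 0 <= k -> cone (x * k).
Proof. by move=> k0; exists 0, k; rewrite add0r mulrC. Qed.

Lemma cone_conj u : cone u -> cone (x * u^*).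
Proof.
move=> [a [b [a0 b0 ->]]]; exists (b * (x^* * x)), a; split=> //.
  by rewrite mulr_ge0 // mulrC mul_conjC_ge0.
rewrite rmorphD rmorphM /= (conj_Creal (ger0_real a0)).
rewrite (conj_Creal (ger0_real b0)).
ring.
Qed.

(** For x in the upper half plane: the argument of g / f is between 0 and the
argument of x. *)
Definition precedes (f g : C) : Prop := cone (f^* * g).

Lemma precedes_refl f : precedes f f.
Proof. by apply: cone_ge0; rewrite mulrC mul_conjC_ge0. Qed.

Lemma precedes0 f : precedes f 0.
Proof. by rewrite /precedes mulr0; apply: cone0. Qed.

Lemma precedes0l f : precedes 0 f.
Proof. by rewrite /precedes rmorph0 mul0r; apply: cone0. Qed.

Lemma precedesDr f g h : precedes f g -> precedes f h -> precedes f (g + h).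
Proof. by rewrite /precedes mulrDr; apply: coneD. Qed.

Lemma precedesDl f g h : precedes f h -> precedes g h -> precedes (f + g) h.
Proof. by rewrite /precedes rmorphD mulrDl; apply: coneD. Qed.

Lemma precedesMr k f g : 0 <= k -> precedes f g -> precedes f (k * g).
Proof. by rewrite /precedes mulrCA; apply: coneM. Qed.

Lemma precedesMl k f g : 0 <= k -> precedes f g -> precedes (k * f) g.
Proof.
rewrite /precedes rmorphM /= -mulrA => k0.
by rewrite (conj_Creal (ger0_real k0)); apply: coneM.
Qed.

Lemma precedes_scale k f g : precedes f g -> precedes (k * f) (k * g).
Proof.
rewrite /precedes rmorphM mulrACA => fg.
by apply: coneM; rewrite // mulrC mul_conjC_ge0.
Qed.

Lemma precedes_sumr (I : Type) (r : seq I) (P : pred I) f (F : I -> C) :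
  (forall i, P i -> precedes f (F i)) -> precedes f (\sum_(i <- r | P i) F i).
Proof.
move=> fF; apply: (big_ind (precedes f)) => //; first exact: precedes0.
by move=> g h; apply: precedesDr.
Qed.

Lemma precedes_suml (I : Type) (r : seq I) (P : pred I) f (F : I -> C) :
  (forall i, P i -> precedes (F i) f) -> precedes (\sum_(i <- r | P i) F i) f.
Proof.
move=> fF; apply: (big_ind (precedes^~ f)) => //; first exact: precedes0l.
by move=> g h; apply: precedesDl.
Qed.

(** One step of the Eulerian recursion, with lo, mid and hi the sums of three
successive blocks of terms. *)
Lemma precedes_step lo mid hi :
  precedes hi mid -> precedes hi lo -> precedes mid lo ->
  precedes (lo + mid + x * hi) (lo + x * mid + x * hi).
Proof.
rewrite /precedes => hm hl ml.
have -> : (lo + mid + x * hi)^* * (lo + x * mid + x * hi) =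
   (lo + x * hi)^* * (lo + x * hi) + x * (mid^* * mid)
   + x * (mid^* * lo)^* + (x^* * x) * (hi^* * mid)
   + mid^* * lo + x * (hi^* * mid)^*.
  by rewrite !(rmorphD, rmorphM) /= !conjCK; ring.
have sq u : 0 <= u^* * u by rewrite mulrC mul_conjC_ge0.
do ![apply: coneD] => //.
- exact: cone_ge0 (sq _ _).
- exact: coneX (sq _ _).
- exact: cone_conj.
- exact: coneM (sq _ _) _.
- exact: cone_conj.
Qed.

(** If x is not a nonpositive real, the cone contains no line. *)
Hypothesis x_nle0 : ~ x <= 0.

Lemma cone_pointed k u : 0 <= k -> cone u -> k + u = 0 -> k = 0.
Proof.
move=> k0 [a [b [a0 b0 ->]]] e; have [b_0|bn0] := eqVneq b 0.
  move: e; rewrite b_0 mul0r addr0 => /eqP.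
  by rewrite paddr_eq0 // => /andP[/eqP].
case: x_nle0; have -> : x = - ((k + a) / b).
  by apply: (mulfI bn0); rewrite mulrN mulrCA divff // mulr1; apply/eqP;
    rewrite -addr_eq0; apply/eqP; rewrite -[RHS]e; ring.
by rewrite oppr_le0 divr_ge0 ?addr_ge0.
Qed.

Lemma precedes_neq0 k f g : 0 < k -> f != 0 -> precedes f g -> k * f + g != 0.
Proof.
move=> k0 f0 fg; apply/eqP => e.
have : (k * (f^* * f) = 0).
  apply: (cone_pointed _ fg).
    by rewrite mulr_ge0 ?(ltW k0) // mulrC mul_conjC_ge0.
  by rewrite -(mulr0 f^*) -e; ring.
by move/eqP; rewrite mulf_eq0 mulrC mul_conjC_eq0 (negPf f0) gt_eqF.
Qed.

(** By Abel summation, a combination of the c_i with nondecreasing nonnegative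
coefficients is a nonnegative combination of tails of the sum of the c_i, and
every tail precedes the whole sum. *)
Lemma precedes_rising n (c rho : nat -> C) :
  (forall i l, (i <= l < n)%N -> precedes (c l) (c i)) ->
  0 <= rho 0 -> (forall i, (i.+1 < n)%N -> rho i <= rho i.+1) ->
  precedes (\sum_(0 <= i < n) rho i * c i) (\sum_(0 <= i < n) c i).
Proof.
elim: n c rho => [|n IH] c rho cc r0 rS.
  by rewrite !big_geq //; apply: precedes0.
have rmono i : (i < n.+1)%N -> rho 0 <= rho i.
  elim: i => // i IHi lt_in; apply: le_trans (rS _ lt_in).
  by apply: IHi; apply: ltnW.
have -> : \sum_(0 <= i < n.+1) rho i * c i = rho 0 * \sum_(0 <= i < n.+1) c i
    + \sum_(0 <= i < n) (rho i.+1 - rho 0) * c i.+1.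
  rewrite !big_nat_recl // mulrDr -addrA mulr_sumr -big_split /=.
  by congr (_ + _); apply: eq_bigr => i _; ring.
apply: precedesDl; first exact: precedesMl (precedes_refl _).
rewrite [X in precedes _ X]big_nat_recl //; apply: precedesDr.
  rewrite big_nat; apply: precedes_suml => i /andP[_ lt_in].
  by apply: precedesMl; [rewrite subr_ge0 rmono | apply: cc].
case: n => [|n] in IH cc rS rmono *.
  by rewrite !big_geq //; apply: precedes0.
apply: (IH (fun i => c i.+1) (fun i => rho i.+1 - rho 0)).
- by move=> i l il; apply: cc.
- by rewrite subr_ge0 rS.
- by move=> i lt_in; rewrite lerD2r rS.
Qed.

End Cone.

(** * Nonvanishing outside [-1, 0] *)

Section Outside.
Variables (C : numClosedFieldType) (s : pred nat) (z : C).
Hypothesis z_out : ~~ (-1 <= z <= 0).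

Let x := z / (1 + z).

Lemma addz_neq0 : 1 + z != 0.
Proof.
apply: contra z_out => /eqP e.
have -> : z = -1 by rewrite -(addr0 (-1)) -e; ring.
by rewrite lexx lerN10.
Qed.

Lemma zE : z = (1 + z) * x.
Proof. by rewrite /x mulrCA divff ?mulr1 // addz_neq0. Qed.

Lemma x_nle0 : ~ x <= 0.
Proof.
move=> x0; have y0 : 0 <= - x by rewrite oppr_ge0.
have x1 : 1 - x != 0 by rewrite gt_eqF // ltr_wpDr.
have zx : z = x / (1 - x).
  apply: (mulIf x1); rewrite divfK // mulrBr mulr1 {1}zE; ring.
case/negP: z_out; rewrite zx.
have x1p : 0 < 1 - x by rewrite ltr_wpDr.
by rewrite ler_pdivlMr // ler_pdivrMr // mul0r x0 mulN1r opprB lerBlDr lerDl ler01.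
Qed.

(** The terms are split at i and at l: the recursion turns the sums of the three
parts into the two combinations of [precedes_step], up to the common factor
1 + z. *)
Lemma refined_precedes J i l : (i <= l <= J)%N ->
  precedes x (refined s z J l) (refined s z J i).
Proof.
elim: J i l => [|J IH] i l.
  by case: i l => [|i] [|l] //= _; apply: precedes_refl.
move=> /andP[il lJ] /=; set w := (s J.+1)%:R * z.
pose S a b := \sum_(a <= k < b) refined s z J k.
have sepS a b c : (b <= c <= J.+1)%N -> precedes x (S b c) (S a b).
  move=> bc; rewrite /S !big_nat.
  apply: precedes_suml => k /andP[bk kc].
  apply: precedes_sumr => k' /andP[ak k'b].
  by apply: IH; lia.
rewrite -!/(S _ _).
have -> : S 0 l = S 0 i + S i l by rewrite /S -big_cat_nat.
have -> : S 0 J.+1 = S 0 i + S i l + S l J.+1.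
  by rewrite /S -!big_cat_nat //; lia.
have hl : precedes x (S l J.+1) (S 0 i).
  rewrite /S !big_nat.
  apply: precedes_suml => k /andP[bk kc].
  apply: precedes_sumr => k' /andP[ak k'b].
  by apply: IH; lia.
have hm : precedes x (S l J.+1) (S i l) by apply: sepS; rewrite lJ leqnn.
have ml : precedes x (S i l) (S 0 i) by apply: sepS; rewrite il.
rewrite /w; case: (s J.+1); last first.
  rewrite !mul0r !addr0; apply: precedesDl => //; exact: precedes_refl.
rewrite mul1r; have zM T : z * T = (1 + z) * (x * T) by rewrite mulrA -zE.
have -> : S 0 i + S i l + z * (S 0 i + S i l + S l J.+1)
   = (1 + z) * (S 0 i + S i l + x * S l J.+1).
  by rewrite [RHS]mulrDr -zM; ring.
have -> : S 0 i + z * (S 0 i + S i l + S l J.+1)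
   = (1 + z) * (S 0 i + x * S i l + x * S l J.+1).
  by rewrite [RHS]mulrDr [X in _ = X + _]mulrDr -!zM; ring.
by apply: precedes_scale; apply: precedes_step.
Qed.

(** The last term precedes all others, so after multiplication by its conjugate
the sum is a positive number plus an element of the cone. *)
Lemma combination_neq0 J (w : nat -> C) : refined s z J J != 0 ->
  (forall i, (i <= J)%N -> 0 < w i) ->
  \sum_(0 <= i < J.+1) w i * refined s z J i != 0.
Proof.
move=> last0 w0; rewrite big_nat_recr //= addrC.
apply: (precedes_neq0 x_nle0) => //; first exact: w0.
rewrite big_nat; apply: precedes_sumr => i /andP[_ iJ].
by apply: precedesMr; [apply/ltW/w0/ltnW | apply: refined_precedes; lia].
Qed.

(** At i = J + 1 the recursion gives the full sum of the previous row, times 1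
or 1 + z. *)
Lemma refined_last J : refined s z J J != 0.
Proof.
elim: J => [|J IH] /=.
  by case: (s 0); rewrite ?mul1r ?mul0r ?addr0 ?oner_eq0 ?addz_neq0.
rewrite -[X in X + _]mul1r -mulrDl mulf_neq0 //.
  by case: (s J.+1); rewrite ?mul1r ?mul0r ?addr0 ?oner_eq0 ?addz_neq0.
under eq_bigr do rewrite -[refined _ _ _ _]mul1r.
exact: combination_neq0.
Qed.

Lemma boolean_cp_neq0 J n : (J < n)%N -> boolean_cp s z J n != 0.
Proof.
move=> Jn; apply: combination_neq0 => [|i iJ]; first exact: refined_last.
by rewrite ltr0n bin_gt0; lia.
Qed.

(** The ratio C(m - i, d - i) / C(n - i, d - i) is nondecreasing in i when
m <= n, since passing from i to i + 1 multiplies it by (n - i) / (m - i). *)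
Lemma bin_ratio d m n i : (i < d)%N -> (d <= m <= n)%N ->
  ('C(m - i, d - i) * 'C(n - i.+1, d - i.+1)
     <= 'C(m - i.+1, d - i.+1) * 'C(n - i, d - i))%N.
Proof.
move=> lt_id /andP[dm mn].
have E k : (d <= k)%N ->
    ((d - i) * 'C(k - i, d - i) = (k - i) * 'C(k - i.+1, d - i.+1))%N.
  move=> dk; rewrite !subnS -(prednK (_ : 0 < d - i)%N) ?subn_gt0 //.
  by rewrite -mul_bin_diag.
rewrite -(leq_pmul2l (_ : 0 < d - i)%N) ?subn_gt0 //.
rewrite mulnA E // mulnCA E ?(leq_trans dm) //.
have mni : (m - i <= n - i)%N by lia.
move: (m - i)%N (n - i)%N mni => a b ab.
by rewrite -mulnA [X in (_ <= X)%N]mulnCA leq_mul2r ab orbT.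
Qed.

Lemma paving_neq0 J n (ms : seq nat) :
  (J < n)%N -> (forall m, m \in ms -> (J < m <= n)%N) ->
  ('C(n, J.+1) <= \sum_(m <- ms) 'C(m, J.+1))%N ->
  boolean_cp s z J n + z * (\sum_(m <- ms) boolean_cp s z J m) != 0.
Proof.
move=> Jn msP cover.
set p := boolean_cp s z J n; set q := \sum_(m <- ms) _.
pose E m i : C := 'C(m - i, J.+1 - i)%:R.
(* The index is shifted by one with respect to the weights, so that ratio 0 is
   the quotient bounded below by the hypothesis on the blocks. *)
pose ratio i := (\sum_(m <- ms) E m i) / E n i.
pose c i := E n i.+1 * refined s z J i.
pose rho i := ratio i.+1 - 1.
have E_gt0 i : (i <= J.+1)%N -> 0 < E n i.
  by move=> iJ; rewrite ltr0n bin_gt0; lia.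
have pE : p = \sum_(0 <= i < J.+1) c i by [].
have qE : q = p + \sum_(0 <= i < J.+1) rho i * c i.
  rewrite pE -big_split /q exchange_big /=; apply: eq_big_nat => i /andP[_ iJ].
  rewrite -mulr_suml /rho /c mulrBl mul1r addrC subrK mulrA /ratio.
  by rewrite divfK // gt_eqF // E_gt0.
have ratioS i : (i <= J)%N -> ratio i <= ratio i.+1.
  move=> iJ; rewrite /ratio ler_pdivrMr ?(E_gt0 i (leqW iJ)) //.
  rewrite mulrAC ler_pdivlMr ?(E_gt0 i.+1 iJ) //.
  rewrite !mulr_suml big_seq [leRHS]big_seq; apply: ler_sum => m /msP Jmn.
  by rewrite -!natrM ler_nat; apply: bin_ratio; lia.
have ratio0 : 1 <= ratio 0.
  rewrite ler_pdivlMr ?E_gt0 // mul1r /E -natr_sum !subn0 ler_nat.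
  by under eq_bigr do rewrite subn0.
set g := \sum_(0 <= i < J.+1) rho i * c i in qE.
have gp : precedes x g p.
  rewrite pE; apply: (@precedes_rising _ _ _ c rho).
  - move=> i l il; rewrite /c; apply: precedesMr; first exact: ler0n.
    by apply: precedesMl; [exact: ler0n | apply: refined_precedes; lia].
  - by rewrite subr_ge0 (le_trans ratio0) // ratioS.
  - by move=> i iJ; rewrite lerD2r ratioS.
have -> : p + z * q = (1 + z) * (p + x * g).
  by rewrite qE [RHS]mulrDr mulrA -zE; ring.
rewrite mulf_neq0 ?addz_neq0 //; apply/eqP => e.
have pn0 : p != 0 by exact: boolean_cp_neq0.
have [g0|gn0] := eqVneq g 0.
  by move: e; rewrite g0 mulr0 addr0; apply/eqP.
(* The conjugate of p + x g = 0 times x g is a sum of two cone elements. *)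
have xn0 : x != 0 by apply/eqP => x0; apply: x_nle0; rewrite x0.
have : x * x^* * (g * g^*) = 0.
  apply: (cone_pointed x_nle0 _ (cone_conj gp)).
    by rewrite mulr_ge0 ?mul_conjC_ge0.
  rewrite [(g^* * p)^*]rmorphM /= conjCK.
  have -> : x * x^* * (g * g^*) + x * (g * p^*) = x * g * (p + x * g)^*.
    have -> : (p + x * g)^* = p^* + x^* * g^*.
      by rewrite -(rmorphM _ x g) -rmorphD.
    by ring.
  by rewrite e rmorph0 mulr0.
by apply/eqP; rewrite mulf_neq0 ?mul_conjC_eq0.
Qed.

End Outside.

(** * Generating functions of chains *)

Lemma is_chainP {disp} {P : finPOrderType disp} (A : {set P}) :
  reflect {in A &, forall x y, (x >=< y)%O} (is_chain A).
Proof.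
apply: (iffP forall_inP) => [h x y xA yA|h x xA].
  by have /forall_inP := h x xA; apply.
by apply/forall_inP => y yA; apply: h.
Qed.

Section ChainPolynomial.
Variable R : nzRingType.

Definition chain_gf {disp} {P : finPOrderType disp} (X : {set P}) : {poly R} :=
  \sum_(A : {set P} | is_chain A && (A \subset X)) 'X^#|A|.

Lemma chain_gf_mono disp disp' (P : finPOrderType disp)
    (Q : finPOrderType disp') (g : P -> Q) (X : {set P}) :
  {mono g : x y / (x <= y)%O} -> chain_gf (g @: X) = chain_gf X.
Proof.
move=> g_mono; have g_inj := inc_inj g_mono.
rewrite /chain_gf (reindex_onto (fun A : {set P} => g @: A)
                                   (fun B : {set Q} => g @^-1: B)) /=.
  apply: eq_big => [A|A _]; last by rewrite card_imset.
  have -> : g @^-1: (g @: A) == A.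
    by apply/eqP/setP => x; rewrite inE mem_imset.
  rewrite andbT; congr (_ && _).
    apply/is_chainP/is_chainP => h x y.
      move=> xA yA; have := h (g x) (g y).
      by rewrite !mem_imset // /Order.comparable !g_mono; apply.
    move=> /imsetP[x' xA ->] /imsetP[y' yA ->].
    by rewrite /Order.comparable !g_mono; apply: h.
  apply/subsetP/subsetP => h x; last first.
    by move=> /imsetP[y yA ->]; rewrite mem_imset // h.
  by move=> xA; have := h (g x); rewrite !mem_imset //; apply.
move=> B /andP[_ /subsetP sB]; apply/setP => y; apply/imsetP/idP.
  by move=> [x]; rewrite inE => ? ->.
by move=> yB; have /imsetP[x _ e] := sB y yB; exists x; rewrite // inE -e.
Qed.

Lemma chain_gf_top disp (P : finPOrderType disp) (X : {set P}) (u : P) :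
  u \in X -> (forall y, y \in X -> ~~ (u < y)%O) ->
  \sum_(A : {set P} | is_chain A && (A \subset X) && (u \in A)) 'X^#|A|
  = 'X * chain_gf [set y in X | (y < u)%O].
Proof.
move=> uX u_max; rewrite /chain_gf mulr_sumr.
rewrite (reindex_onto (fun B : {set P} => u |: B)
                      (fun A : {set P} => A :\ u)) /=; last first.
  by move=> A /andP[_ uA]; rewrite setD1K.
apply: eq_big => [B|B]; last first.
  move=> /andP[_ /eqP e]; have uB : u \notin B by rewrite -e setD11.
  by rewrite cardsU1 uB exprS.
rewrite setU11 andbT; apply/idP/idP.
  move=> /andP[/andP[/is_chainP ch /subsetP sub] /eqP e].
  have uB : u \notin B by rewrite -e setD11.
  apply/andP; split.
    by apply/is_chainP => x y xB yB; apply: ch; rewrite !inE ?xB ?yB orbT.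
  apply/subsetP => y yB; have yX : y \in X by apply: sub; rewrite !inE yB orbT.
  rewrite inE yX /=; have := ch y u; rewrite !inE yB orbT eqxx => /(_ isT isT).
  rewrite comparable_sym => cmp; case: (comparable_ltgtP cmp) => //.
    by move=> uy; rewrite (negPf (u_max y yX)) in uy.
  by move=> uy; rewrite uy yB in uB.
move=> /andP[/is_chainP ch /subsetP sub].
have uB : u \notin B by apply/negP => /sub; rewrite inE ltxx andbF.
rewrite setU1K // eqxx andbT; apply/andP; split.
  apply/is_chainP => x y /setU1P[->|xB] /setU1P[->|yB].
  - exact: comparablexx.
  - by move: (sub _ yB); rewrite inE => /andP[_ /ltW ?]; apply: ge_comparable.
  - by move: (sub _ xB); rewrite inE => /andP[_ /ltW ?]; apply: le_comparable.
  - exact: ch.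
by apply/subsetP => y /setU1P[->|/sub]; rewrite // inE => /andP[].
Qed.

(** The elements of U are maximal in X, so a chain of X contains at most one of
them, and then as its top element. *)
Lemma chain_gf_split disp (P : finPOrderType disp) (X U : {set P}) :
  U \subset X -> (forall u y, u \in U -> y \in X -> ~~ (u < y)%O) ->
  chain_gf X
    = chain_gf (X :\: U) + 'X * \sum_(u in U) chain_gf [set y in X | (y < u)%O].
Proof.
move=> /subsetP UX U_max; rewrite mulr_sumr.
rewrite -(eq_bigr _ (fun u uU =>
  chain_gf_top (UX u uU) (fun y => @U_max u y uU))).
rewrite (exchange_big_dep (fun A => is_chain A && (A \subset X))) /=; last first.
  by move=> u A _ /andP[].
rewrite {1}/chain_gf (bigID (fun A : {set P} => [disjoint A & U])) /=; congr (_ + _).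
  by apply: eq_bigl => A; rewrite subsetD andbA.
rewrite [RHS](bigID (fun A : {set P} => [disjoint A & U])) /=.
rewrite [X in X + _]big1 ?add0r.
  apply: eq_bigr => A /andP[chA].
  have [/is_chainP ch /subsetP AX] := andP chA.
  case/pred0Pn=> u /andP[/= uA uU].
  rewrite (bigD1 u) /=; last by rewrite uU chA.
  rewrite big1 ?addr0 // => v /andP[/andP[vU /andP[_ vA]] vu].
  case: (comparable_ltgtP (ch u v uA vA)) vu => //.
  - by move=> lt_uv; rewrite (negPf (U_max _ _ uU (AX _ vA))) in lt_uv.
  - by move=> lt_uv; rewrite (negPf (U_max _ _ vU (AX _ uA))) in lt_uv.
move=> A /andP[_ dAU]; rewrite big1 // => u /andP[uU /andP[_ uA]].
by rewrite (disjointFr dAU uA) in uU.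
Qed.

Lemma chain_gf0 disp (P : finPOrderType disp) :
  chain_gf (set0 : {set P}) = 1.
Proof.
rewrite /chain_gf (bigD1 set0) /=; last first.
  by rewrite subxx andbT; apply/is_chainP => x y; rewrite inE.
rewrite cards0 expr0 big1 ?addr0 // => A /andP[/andP[_]].
by rewrite subset0 => /eqP ->; rewrite eqxx.
Qed.

Lemma chain_gf1 disp (P : finPOrderType disp) (p : pred P) (u : P) :
  chain_gf [set y | (y == u) && p y] = 1 + (p u)%:R * 'X.
Proof.
case pu: (p u); last first.
  rewrite mul0r addr0 -(chain_gf0 P); congr chain_gf.
  by apply/setP => y; rewrite !inE; apply/andP => -[/eqP->]; rewrite pu.
have -> : [set y | (y == u) && p y] = [set u].
  by apply/setP => y; rewrite !inE; case: eqP => // ->; rewrite pu.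
rewrite (chain_gf_split (subxx _)); last first.
  by move=> v y /set1P -> /set1P ->; rewrite ltxx.
rewrite setDv chain_gf0 big_set1 mul1r.
have -> : [set y in [set u] | (y < u)%O] = set0; last by rewrite chain_gf0 mulr1.
by apply/setP => y; rewrite !inE; case: eqP => //= ->; rewrite ltxx.
Qed.

Lemma chain_gf_greatest disp (P : finPOrderType disp) (X : {set P}) (u : P) :
  (forall y, y <= u)%O ->
  chain_gf X = (1 + (u \in X)%:R * 'X) * chain_gf (X :\ u).
Proof.
move=> u_max; case uX: (u \in X); last first.
  rewrite mul0r addr0 mul1r; congr chain_gf; apply/setP => y; rewrite !inE.
  by case: eqP => // ->.
rewrite (@chain_gf_split _ _ X [set u]); first last.
- by move=> v y /set1P-> _; apply/negP => /lt_le_trans/(_ (u_max y)); rewrite ltxx.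
- by rewrite sub1set.
rewrite big_set1 mulrDl mul1r mul1r; congr (_ + 'X * chain_gf _).
by apply/setP => y; rewrite !inE lt_neqAle u_max andbT andbC.
Qed.

End ChainPolynomial.

Lemma chain_polyE (R : realType) disp (P : finPOrderType disp) :
  chain_poly R P = chain_gf R [set: P].
Proof.
apply/polyP => k; rewrite coef_poly coef_sum.
under eq_bigr do rewrite coefXn.
have -> : \sum_(A : {set P} | is_chain A && (A \subset [set: P])) (k == #|A|)%:R
   = (chain_count P k)%:R :> R.
  rewrite -natr_sum; congr _%:R.
  rewrite /chain_count -sum1_card big_mkcond [RHS]big_mkcond.
  apply: eq_bigr => A _; rewrite inE subsetT andbT eq_sym.
  by case: is_chain => //=; case: eqP.
case: ltnP => // kP; rewrite /chain_count eq_card0 // => A.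
by rewrite !inE; apply/andP => -[_ /eqP e]; move: (max_card A); rewrite e leqNgt kP.
Qed.

Lemma chain_poly_rank_selected (R : realType) disp (L : finPOrderType disp)
    (rho : L -> nat) (S : set nat) :
  chain_poly R (rank_selected rho S) = chain_gf R [set x | rho x \in S].
Proof.
rewrite chain_polyE -(chain_gf_mono R [set: rank_selected rho S]
  (g := val : rank_selected rho S -> L)) //.
congr chain_gf; apply/setP => x; rewrite inE; apply/imsetP/idP.
  by move=> [y _ ->]; apply: (valP y).
by move=> xS; exists (Sub x xS : rank_selected rho S); rewrite // SubK.
Qed.

Lemma ltEproper (T : finType) (A B : {set T}) : (A < B)%O = (A \proper B).
Proof. by rewrite lt_def Order.SetSubsetOrder.leEsubset properEneq eq_sym. Qed.

(** If J + 1 is in s, the sets of that size are maximal, and below each of them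
lie its own subsets of selected size at most J; so this is the recursion
[boolean_cpS]. *)
Lemma chain_gf_boolean (R : comNzRingType) (T : finType) (s : pred nat) J
    (U : {set T}) :
  (J < #|U|)%N ->
  chain_gf R [set A : {set T} | [&& A \subset U, s #|A| & (#|A| <= J)%N]]
    = boolean_cp s 'X J #|U|.
Proof.
elim: J U => [|J IH] U JU.
  have /= := chain_gf1 R (fun A : {set T} => s #|A|) set0.
  rewrite boolean_cp0 cards0 => <-.
  congr chain_gf; apply/setP => A; rewrite !inE leqn0 cards_eq0.
  by case: eqP => [->|_]; rewrite ?sub0set ?andbT ?andbF.
pose X := [set A : {set T} | [&& A \subset U, s #|A| & (#|A| <= J.+1)%N]].
pose V := [set A in X | #|A| == J.+1].
rewrite -/X (@chain_gf_split _ _ _ X V); first last.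
- move=> A B; rewrite !inE => /andP[_ /eqP cA] /and3P[_ _ cB].
  by rewrite ltEproper; apply/negP => /proper_card; rewrite cA ltnNge cB.
- by apply/subsetP => A; rewrite inE => /andP[].
have [J1 J2] : (J < #|U|)%N /\ (J < J.+1)%N by split=> //; apply: ltnW.
rewrite boolean_cpS // -(IH U J1); congr (_ + _).
  congr chain_gf; apply/setP => A; rewrite !inE.
  rewrite [(#|A| <= J.+1)%N]leq_eqVlt ltnS.
  by case: eqP => [->|_]; rewrite ?ltnn ?andbT ?andbF ?andNb //= ?andbF.
under eq_bigr => A AV.
  have /[!inE] /andP[/and3P[AU sA cA] /eqP cA'] := AV.
  have -> : [set B in X | (B < A)%O]
      = [set B : {set T} | [&& B \subset A, s #|B| & (#|B| <= J)%N]].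
    apply/setP => B; rewrite !inE ltEproper; apply/idP/idP.
      move=> /andP[/and3P[BU -> _] BA]; rewrite (proper_sub BA) /=.
      by rewrite -ltnS -cA' proper_card.
    move=> /and3P[BA -> cB]; rewrite (subset_trans BA AU) (leqW cB) /=.
    by rewrite properEcard BA cA' ltnS.
  rewrite IH cA' //.
  over.
rewrite sumr_const -[in LHS]mulr_natl.
suff -> : #|V| = (s J.+1 * 'C(#|U|, J.+1))%N by rewrite natrM; ring.
case sJ: (s J.+1); last first.
  apply: eq_card0 => A; rewrite !inE; apply/andP => -[/and3P[_ sA _] /eqP cA].
  by rewrite cA sJ in sA.
rewrite mul1n -cards_draws; apply: eq_card => A; rewrite !inE.
by case: eqP => [->|_]; rewrite ?andbF // sJ leqnn !andbT.
Qed.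

(** * Rank functions *)

Lemma below_card disp (P : finPOrderType disp) (x y : P) :
  (x < y)%O -> (#|[set w | (w < x)%O]| < #|[set w | (w < y)%O]|)%N.
Proof.
move=> xy; apply: proper_card; apply/properP; split.
  by apply/subsetP => w; rewrite !inE => /lt_trans; apply.
by exists x; rewrite !inE ?ltxx.
Qed.

Lemma cover_below disp (P : finPOrderType disp) (x y : P) :
  (x < y)%O -> exists2 z, (x <= z)%O & covers z y.
Proof.
move=> xy; pose p := [pred z | (x <= z < y)%O].
have px : p x by rewrite /= lexx.
case: (arg_maxnP (fun z => #|[set w | (w < z)%O]|) px) => z /andP[xz zy] z_max.
exists z => //; rewrite /covers zy /=; apply/existsP => -[w /andP[zw wy]].
have /z_max : p w by rewrite /= wy (le_trans xz (ltW zw)).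
by rewrite /= leqNgt below_card.
Qed.

Lemma rank_lt disp (L : finTBLatticeType disp) (rho : L -> nat) (x y : L) :
  is_rank_function rho -> (x < y)%O -> (rho x < rho y)%N.
Proof.
move=> [_ rhoS]; have [k] := ubnP #|[set w | (w < y)%O]|.
elim: k y => // k IH y yk xy; have [z xz zy] := cover_below xy.
rewrite (rhoS _ _ zy) ltnS; move: xz; rewrite le_eqVlt => /orP[/eqP -> //|xz].
apply/ltnW/IH => //; apply: leq_trans (below_card _) yk.
by case/andP: zy.
Qed.

Lemma rank_unique disp (L : finTBLatticeType disp) (rho rho' : L -> nat) :
  is_rank_function rho -> is_rank_function rho' -> rho =1 rho'.
Proof.
move=> [rho0 rhoS] [rho'0 rho'S] y; have [k] := ubnP #|[set w | (w < y)%O]|.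
elim: k y => // k IH y yk; have [->|y0] := eqVneq y \bot%O.
  by rewrite rho0 rho'0.
have : (\bot < y)%O by rewrite lt0x.
case/cover_below => z _ zy.
rewrite (rhoS _ _ zy) (rho'S _ _ zy) IH //.
by apply: leq_trans (below_card _) yk; case/andP: zy.
Qed.

(** * Paving posets *)

Lemma exists_subset (T : finType) (B : {set T}) k :
  (k <= #|B|)%N -> exists2 D : {set T}, D \subset B & #|D| = k.
Proof.
rewrite -bin_gt0 -cards_draws => /card_gt0P[D]; rewrite inE => /andP[DB /eqP].
by exists D.
Qed.

Lemma exists_superset (T : finType) (B : {set T}) k :
  (#|B| <= k <= #|T|)%N -> exists2 D : {set T}, B \subset D & #|D| = k.
Proof.
move=> /andP[Bk kT]; have := cardsC B => BC.
have [D DB Dk] := @exists_subset T (~: B) (k - #|B|) ltac:(lia).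
exists (B :|: D); rewrite ?subsetUl // cardsU Dk.
suff -> : B :&: D = set0 by rewrite cards0; lia.
by apply/eqP; rewrite setI_eq0 disjoint_sym disjoints_subset.
Qed.

Section Paving.
Variables (n d : nat) (H : {set {set 'I_n}}).
Hypotheses (Hd : d_partition d H) (Hcov : cover H = [set: 'I_n]).

Lemma block_card A : A \in H -> (d <= #|A|)%N.
Proof. by case: Hd => _ + _; apply. Qed.

Lemma block_antichain A B : A \in H -> B \in H -> A \subset B -> A = B.
Proof.
case: Hd => _ _ uniq AH BH AB.
have [D DA Dd] := exists_subset (block_card AH).
have [E [_ E_uniq]] := uniq D ltac:(by rewrite Hcov subsetT) Dd.
rewrite -(E_uniq A) ?AH // -(E_uniq B) //.
by rewrite BH (subset_trans DA).
Qed.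

Lemma block_neqT A : A \in H -> A != [set: 'I_n].
Proof.
move=> AH; apply/eqP => AT; case: Hd; rewrite (cardD1 A) AH => + _ _.
rewrite add1n ltnS => /card_gt0P[B /andP[/= BA BH]].
by case/eqP: BA; apply: block_antichain; rewrite // AT subsetT.
Qed.

Lemma block_bounds A : A \in H -> (d <= #|A| < n)%N.
Proof.
move=> AH; rewrite block_card //= -[n in X in (_ < X)%N]card_ord -cardsT.
by apply: proper_card; rewrite properT block_neqT.
Qed.

Lemma ground_card : (d < n)%N.
Proof.
case: Hd => /ltnW /card_gt0P[A AH] _ _.
by have /andP[dA] := block_bounds AH; apply: leq_ltn_trans.
Qed.

Lemma block_above (A : {set 'I_n}) :
  (#|A| <= d)%N -> exists2 B : {set 'I_n}, B \in H & A \subset B.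
Proof.
move=> Ad; have [|D AD Dd] := @exists_superset _ A d.
  by rewrite Ad card_ord ltnW // ground_card.
case: Hd => _ _ /(_ D); rewrite Hcov subsetT => /(_ isT Dd)[B [/andP[BH DB] _]].
by exists B; rewrite // (subset_trans AD).
Qed.

(** Union bound: every d-subset lies in some block. *)
Lemma bin_blocks : ('C(n, d) <= \sum_(A : {set 'I_n} | A \in H) 'C(#|A|, d))%N.
Proof.
rewrite -[n in 'C(n, _)]card_ord -card_draws -sum1_card.
under [leqRHS]eq_bigr => A AH do rewrite -cards_draws -sum1_card.
rewrite (exchange_big_dep
  (fun D => D \in [set D : {set 'I_n} | #|D| == d])) /=; last first.
  by move=> A D _; rewrite !inE => /andP[].
apply: leq_sum => D Dd; have [|A AH DA] := @block_above D.
  by move: Dd; rewrite inE => /eqP ->.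
rewrite (bigD1 A) //= AH inE DA.
by rewrite -[_ == _](in_set (fun D : {set 'I_n} => #|D| == d)) Dd.
Qed.

(** On the members of the paving poset this is the rank function: the blocks
have at least d elements, so for d > 0 the first test never captures one. *)
Definition paving_rank (A : {set 'I_n}) : nat :=
  if (#|A| <= d.-1)%N then #|A| else if A \in H then d else d.+1.

Hypothesis d_gt0 : (0 < d)%N.

Lemma paving_rank_block A : A \in H -> paving_rank A = d.
Proof.
move=> AH; rewrite /paving_rank AH leqNgt prednK //.
by rewrite block_card.
Qed.

Lemma paving_rankT : paving_rank [set: 'I_n] = d.+1.
Proof.
rewrite /paving_rank cardsT card_ord ifN; last by have := ground_card; lia.
by rewrite ifN //; apply/negP => /block_neqT; rewrite eqxx.
Qed.

Lemma paving_rank_small (A : {set 'I_n}) : (#|A| < d)%N -> paving_rank A = #|A|.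
Proof. by move=> Ad; rewrite /paving_rank -ltnS prednK // Ad. Qed.

Variant paving_spec (A : {set 'I_n}) : nat -> Prop :=
  | PavingSmall of (#|A| < d)%N : paving_spec A #|A|
  | PavingBlock of A \in H & (d <= #|A|)%N : paving_spec A d
  | PavingFull of A = [set: 'I_n] : paving_spec A d.+1.

Lemma pavingP A : paving_mem H d A -> paving_spec A (paving_rank A).
Proof.
rewrite /paving_mem -ltnS prednK // => /or3P[Ad|AH|/eqP ->].
- by rewrite paving_rank_small //; constructor.
- by rewrite paving_rank_block //; constructor; rewrite // block_card.
- by rewrite paving_rankT; constructor.
Qed.

(** If the step from A to B skipped a rank, then adding one element of B to A,
or taking a block that contains A, would produce a member strictly between. *)
Lemma paving_rank_cover A B :
  paving_mem H d A -> paving_mem H d B -> A \proper B ->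
  (forall E, paving_mem H d E -> ~~ ((A \proper E) && (E \proper B))) ->
  paving_rank B = (paving_rank A).+1.
Proof.
move=> pA pB AB nE.
have ABc := proper_card AB.
have small (E : {set 'I_n}) : (#|E| < d)%N -> paving_mem H d E.
  by rewrite /paving_mem -[(_ <= d.-1)%N]ltnS prednK // => ->.
have step : (#|A|.+1 < d)%N -> #|B| = #|A|.+1.
  move=> Ad; have /properP[sAB [b bB bA]] := AB.
  have cA : #|b |: A| = #|A|.+1 by rewrite cardsU1 bA.
  have /nE := small (b |: A) ltac:(by rewrite cA).
  rewrite properEcard subsetUr cA ltnSn /= properEcard subUset sub1set bB sAB /=.
  by rewrite cA -leqNgt => ?; apply/eqP; rewrite eqn_leq ABc andbT.
case: (pavingP pB) => [Bd|BH dB|BT].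
- by rewrite paving_rank_small ?step //; lia.
- case: (pavingP pA) => [Ad|AH _|AT].
  + by apply/eqP; rewrite eqn_leq Ad andbT leqNgt; apply/negP => /[dup] /step; lia.
  + by move: (AB); rewrite (block_antichain AH BH (proper_sub AB)) properxx.
  + by move: AB; rewrite AT properE subsetT andbF.
- case: (pavingP pA) => [Ad|AH _|AT] //; last by move: AB; rewrite AT BT properxx.
  have [E EH AE] := block_above (ltnW Ad).
  have /nE/negP[] : paving_mem H d E by rewrite /paving_mem EH orbT.
  rewrite properEcard AE (leq_trans Ad) ?block_card //=.
  by rewrite BT properT block_neqT.
Qed.

Lemma paving_chain_gf (R : comNzRingType) (s : pred nat) :
  chain_gf R [set A | paving_mem H d A && s (paving_rank A)] =
    (1 + (s d.+1)%:R * 'X) *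
    (boolean_cp s 'X d.-1 n
     + (s d)%:R * 'X * \sum_(m <- [seq #|A : {set 'I_n}| | A <- enum H])
                          boolean_cp s 'X d.-1 m).
Proof.
have dn := ground_card.
set Y := [set A | _].
pose Y1 := Y :\ [set: 'I_n].
pose Y2 := [set A : {set 'I_n} | s #|A| & (#|A| <= d.-1)%N].
have memT : paving_mem H d [set: 'I_n] by rewrite /paving_mem eqxx !orbT.
rewrite (@chain_gf_greatest R _ _ Y [set: 'I_n]); last first.
  by move=> A; rewrite Order.SetSubsetOrder.leEsubset subsetT.
rewrite [_ \in Y]inE memT paving_rankT andTb; congr (_ * _); rewrite -/Y1.
have smallE (A : {set 'I_n}) : (#|A| <= d.-1)%N = (#|A| < d)%N.
  by rewrite -ltnS prednK.
have block_large (A : {set 'I_n}) : A \in H -> (#|A| < d)%N = false.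
  by move=> AH; rewrite ltnNge block_card.
have inY2 A : (A \in Y2) = (A \in Y1) && (A \notin H).
  rewrite !inE; case pA: (paving_mem H d A); last first.
    move: pA; rewrite /paving_mem andbF /=.
    by case: (#|A| <= d.-1)%N; rewrite ?andbF.
  case: (pavingP pA) => [Ad|AH dA|->].
  - rewrite smallE Ad andbT /=; case: eqP => [AT|_].
      by move: Ad; rewrite AT cardsT card_ord ltnNge ltnW.
    by case AH: (A \in H); rewrite ?andbT //; rewrite block_large in Ad.
  - by rewrite smallE block_large // AH !andbF.
  - by rewrite eqxx smallE cardsT card_ord ltnNge ltnW ?andbF.
have Y2E : chain_gf R Y2 = boolean_cp s 'X d.-1 n.
  have := @chain_gf_boolean R _ s d.-1 [set: 'I_n].
  rewrite cardsT card_ord => <-; last lia.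
  by congr chain_gf; apply/setP => A; rewrite !inE subsetT.
case sd: (s d); last first.
  rewrite !mul0r addr0 -Y2E; congr chain_gf; apply/setP => A; rewrite inY2.
  case AH: (A \in H); rewrite ?andbT // andbF !inE.
  by rewrite paving_rank_block // sd !andbF.
rewrite (@chain_gf_split _ _ _ Y1 H); first last.
- move=> A B AH; rewrite !inE ltEproper => /andP[BT /andP[pB _]].
  apply/negP => AB; move: (proper_card AB) BT; case: (pavingP pB) => [Bd|BH _|->].
  + by have := block_card AH; lia.
  + by rewrite (block_antichain AH BH (proper_sub AB)) ltnn.
  + by rewrite eqxx.
- apply/subsetP => A AH; rewrite !inE paving_rank_block // sd block_neqT //.
  by rewrite /paving_mem AH orbT.
congr (_ + _).
  rewrite -Y2E; congr chain_gf; apply/setP => A.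
  by rewrite inY2 inE andbC.
rewrite mul1r big_map big_enum; congr (_ * _).
apply: eq_bigr => A AH.
rewrite -chain_gf_boolean; last by have := block_card AH; lia.
congr chain_gf; apply/setP => B; rewrite inE ltEproper [RHS]inE.
case BH: (B \in H).
  rewrite smallE block_large // !andbF; apply/andP => -[_ BA].
  by move: (BA); rewrite (block_antichain BH AH (proper_sub BA)) properxx.
have -> : (B \in Y1) = (B \in Y2) by rewrite inY2 BH andbT.
rewrite inE andbC; case Bd: (#|B| <= d.-1)%N; rewrite ?andbF //.
rewrite properEcard [(#|B| < #|A|)%N](leq_trans _ (block_card AH)) -?smallE //.
by rewrite andbT.
Qed.

End Paving.

(** * Paving lattices *)

Section Isomorphism.
Variables (disp : Order.disp_t) (L : finTBLatticeType disp) (rho : L -> nat).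
Variables (n d : nat) (H : {set {set 'I_n}}).
Hypotheses (Hd : d_partition d H) (Hcov : cover H = [set: 'I_n]).
Hypothesis d_gt0 : (0 < d)%N.
Variable f : L -> paving_poset H d.
Hypotheses (f_bij : bijective f) (f_mono : {mono f : x y / (x <= y)%O}).
Hypothesis rho_rank : is_rank_function rho.

Let flat (x : L) : {set 'I_n} := val (f x).

Lemma flat_mono : {mono flat : x y / (x <= y)%O}.
Proof. by move=> x y; rewrite -leEsub f_mono. Qed.

Lemma flat_surj A : paving_mem H d A -> exists x, flat x = A.
Proof.
move=> pA; case: f_bij => g _ fK.
by exists (g (Sub A pA)); rewrite /flat fK SubK.
Qed.

Lemma flat_mem x : paving_mem H d (flat x).
Proof. exact: valP (f x). Qed.

Lemma rank_flat : rho =1 fun x => paving_rank d H (flat x).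
Proof.
apply: (rank_unique rho_rank); split=> [|x y /andP[xy nxy]].
  have [|x x0] := @flat_surj set0; first by rewrite /paving_mem cards0.
  have : (flat \bot%O <= flat x)%O by rewrite flat_mono le0x.
  rewrite x0 Order.SetSubsetOrder.leEsubset subset0 => /eqP ->.
  by rewrite paving_rank_small ?cards0.
have lt_flat u v : (flat u \proper flat v) = (u < v)%O.
  by rewrite -ltEproper (leW_mono flat_mono).
apply: (paving_rank_cover Hd Hcov d_gt0 (flat_mem x) (flat_mem y)).
  by rewrite lt_flat.
move=> E /flat_surj[z <-]; rewrite !lt_flat; apply: contra nxy => xzy.
by apply/existsP; exists z.
Qed.

Lemma chain_gf_flat (R : comNzRingType) (s : pred nat) :
  chain_gf R [set x | s (rho x)]
    = chain_gf R [set A | paving_mem H d A && s (paving_rank d H A)].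
Proof.
rewrite -(chain_gf_mono R _ flat_mono); congr chain_gf; apply/setP => A.
rewrite inE; apply/imsetP/idP => [[x sx ->]|/andP[/flat_surj[x <-] sx]].
  by rewrite flat_mem -rank_flat; rewrite inE in sx.
by exists x; rewrite // inE rank_flat.
Qed.

End Isomorphism.

(** In rank 1 or 2 the elements other than the extrema form an antichain, which
may be empty. *)
Lemma chain_gf_low_rank (R : comNzRingType) disp (L : finTBLatticeType disp)
    (rho : L -> nat) (s : pred nat) :
  is_rank_function rho -> (0 < rho \top%O <= 2)%N ->
  chain_gf R [set x | s (rho x)] =
    (1 + (s (rho \top%O))%:R * 'X)
    * ((1 + (s 0)%:R * 'X)
       * (1 + #|[set x | s (rho x) & (\bot < x < \top)%O]|%:R * 'X)).
Proof.
move=> rk /andP[top0 top2]; set M := [set x | _ & _].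
set X := [set x | _]; have rlt x y := @rank_lt _ _ _ x y rk.
have bt : (\bot < \top :> L)%O.
  by rewrite lt0x; apply/eqP => e; move: top0; rewrite e rk.1.
rewrite (@chain_gf_greatest R _ _ X \top%O (@lex1 _ _)) inE; congr (_ * _).
have no_chain4 (a b c e : L) : (a < b)%O -> (b < c)%O -> (c < e)%O -> False.
  move=> /rlt ab /rlt bc /rlt ce; have : (rho e <= 2)%N; last by lia.
  apply: leq_trans top2; have := lex1 e; rewrite le_eqVlt => /orP[/eqP ->|] //.
  by move=> /rlt/ltnW.
have antichain (u v : L) : u \in M -> (v < u)%O -> v = \bot%O.
  rewrite inE => /and3P[_ _ ut] vu; apply/eqP; rewrite -[_ == _]negbK -lt0x.
  by apply/negP => /no_chain4/(_ vu ut).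
pose B := [set x | (x == \bot%O) && s (rho x)].
have BE : chain_gf R B = 1 + (s 0)%:R * 'X by rewrite chain_gf1 rk.1.
rewrite (@chain_gf_split R _ _ (X :\ \top%O) M); first last.
- move=> u v /[!inE] /and3P[_ u0 _] /andP[vt _]; apply/negP => uv.
  have vt' : (v < \top)%O by rewrite lt_neqAle vt lex1.
  exact: no_chain4 u0 uv vt'.
- apply/subsetP => u; rewrite !inE => /and3P[-> _ ut].
  by rewrite andbT lt_eqF.
have -> : (X :\ \top%O) :\: M = B.
  apply/setP => y; rewrite !inE lt0x ltx1.
  case: (eqVneq y \bot%O) => [->|_]; case: (s _); rewrite ?andbF ?andbT //=.
    by rewrite lt_eqF.
  by rewrite andNb.
rewrite (eq_bigr (fun=> chain_gf R B)) => [|u uM].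
  by rewrite sumr_const -[in LHS]mulr_natl BE; ring.
congr chain_gf; apply/setP => y; rewrite !inE; apply/idP/idP.
  move=> /andP[/andP[_ sy] yu]; rewrite sy andbT; apply/eqP.
  exact: antichain yu.
move: uM; rewrite inE => /and3P[_ u0 _] /andP[/eqP -> sb].
by rewrite sb u0 lt_eqF.
Qed.

(** * Location of the zeros *)

(** The order of R[i] compares only complex numbers with equal imaginary parts,
so membership in [-1, 0] includes being real. *)
Definition zeros_within (R : rcfType) (p : {poly R}) : Prop :=
  forall z : R[i], root (map_poly (real_complex R) p) z -> -1 <= z <= 0.

Lemma zeros_withinP (R : realType) (p : {poly R}) :
  zeros_within p -> real_rooted p /\ zeros_in_N1_0 p.
Proof.
move=> pW; split=> [z /pW|y py].
  case: z => a b; rewrite !lecE /= => /andP[_ /andP[/eqP b0 _]].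
  by exists a; rewrite -b0.
have /pW : root (map_poly (real_complex R) p) (real_complex R y).
  by rewrite fmorph_root.
by rewrite -(rmorphN1 (real_complex R)) -(rmorph0 (real_complex R)) !lecR.
Qed.

Section Evaluation.
Variables (R : rcfType) (z : R[i]).

Definition complex_eval : {poly R} -> R[i] :=
  horner_eval z \o map_poly (real_complex R).
HB.instance Definition _ := GRing.RMorphism.on complex_eval.

Lemma complex_evalX : complex_eval 'X = z.
Proof. by rewrite /complex_eval /= map_polyX /horner_eval hornerX. Qed.

Lemma root_complex_eval p :
  root (map_poly (real_complex R) p) z = (complex_eval p == 0).
Proof. by []. Qed.
End Evaluation.

Lemma zeros_within_linear (R : rcfType) (n : nat) :
  zeros_within (1 + n%:R * 'X : {poly R}).
Proof.
move=> z; rewrite root_complex_eval rmorphD rmorph1 rmorphM rmorph_nat /= complex_evalX.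
case: n => [|n]; first by rewrite mul0r addr0 oner_eq0.
rewrite addrC addr_eq0 => /eqP nz.
have n0 : (0 : R[i]) < n.+1%:R by rewrite ltr0n.
have -> : z = - n.+1%:R^-1.
  by apply: (mulfI (lt0r_neq0 n0)); rewrite nz mulrN divff // gt_eqF.
by rewrite lerN2 oppr_le0 invr_ge0 ler0n andbT invf_le1 // ler1n.
Qed.

Lemma zeros_withinM (R : rcfType) (p q : {poly R}) :
  zeros_within p -> zeros_within q -> zeros_within (p * q).
Proof.
move=> pW qW z; rewrite root_complex_eval rmorphM mulf_eq0.
by case/orP; [apply: pW | apply: qW].
Qed.

Lemma zeros_within_paving (R : rcfType) (s : pred nat) (b : bool) J n
    (ms : seq nat) :
  (J < n)%N -> (forall m, m \in ms -> (J < m <= n)%N) ->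
  ('C(n, J.+1) <= \sum_(m <- ms) 'C(m, J.+1))%N ->
  zeros_within (boolean_cp s 'X J n + b%:R * 'X * \sum_(m <- ms) boolean_cp s 'X J m
                 : {poly R}).
Proof.
move=> Jn msP cover z; rewrite root_complex_eval; apply: contraTT => z_out.
have evalE m : complex_eval z (boolean_cp s 'X J m) = boolean_cp s z J m.
  by rewrite (boolean_cp_morph (complex_eval z)) /= complex_evalX.
rewrite rmorphD !rmorphM rmorph_nat /= evalE complex_evalX rmorph_sum /=.
under eq_bigr do rewrite evalE.
case: b; last by rewrite mul0r mul0r addr0 boolean_cp_neq0.
by rewrite mul1r paving_neq0.
Qed.

Lemma zeros_within_rank_selected (R : realType) disp (L : finTBLatticeType disp)
    (rho : L -> nat) (s : pred nat) :
  paving_lattice rho -> zeros_within (chain_gf R [set x | s (rho x)]).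
Proof.
move=> [[rk _ _] [d [top_d paving]]].
have low : (d <= 1)%N -> zeros_within (chain_gf R [set x | s (rho x)]).
  move=> d1; rewrite chain_gf_low_rank ?top_d //.
  by do 2?apply: zeros_withinM; apply: zeros_within_linear.
case: paving => [d0|[d1|[d2 [n [H [Hd Hcov [f f_bij f_mono]]]]]]].
- by apply: low; rewrite d0.
- by apply: low; rewrite d1.
have d_gt0 : (0 < d)%N by apply: ltnW.
rewrite (chain_gf_flat Hd Hcov d_gt0 f_bij f_mono rk) paving_chain_gf //.
apply: zeros_withinM; first exact: zeros_within_linear.
apply: zeros_within_paving; rewrite ?prednK //.
- by rewrite ltnW // (ground_card Hd Hcov).
- move=> m /mapP[A]; rewrite mem_enum => AH ->.
  by have := block_bounds Hd Hcov AH; lia.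
- by rewrite big_map big_enum bin_blocks.
Qed.

Theorem theorem5p6 (R : realType) (disp : Order.disp_t)
    (L : finTBLatticeType disp) (rho : L -> nat) (HL : paving_lattice rho) :
  (real_rooted (chain_poly R L) /\ zeros_in_N1_0 (chain_poly R L)) /\
  (forall S : set nat,
     real_rooted (chain_poly R (rank_selected rho S)) /\
     zeros_in_N1_0 (chain_poly R (rank_selected rho S))).
Proof.
split=> [|S]; apply: zeros_withinP.
  have := @zeros_within_rank_selected R _ _ _ xpredT HL; rewrite chain_polyE.
  by congr (zeros_within (chain_gf R _)); apply/setP => x; rewrite !inE.
rewrite chain_poly_rank_selected.
exact: (@zeros_within_rank_selected R _ _ _ (fun k => k \in S) HL).
Qed.
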